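(* There exists an absolute constant $C_0>1$ such that the following holds. Let $u,v\in(0,1)$, let $n,N$ be positive integers with $$N\ge\left(\frac{C_0}{\gamma_2}\ln\frac{1}{c_{uv}}\right)n,$$ and let $\Gamma=\{\xi_{ij}\}$ be an $N\times n$ random matrix whose entries are independent symmetric real random variables with unit variances, identically distributed within each row, and satisfying $\sup_{\lambda\in\mathbb{R}}\mathbb{P}\{|\xi_{ij}-\lambda|\le u\}\le v$ for all $i,j$. Then $$\mathbb{P}\left(s_n(\Gamma)\le\frac{c_{uv}\sqrt{\gamma_2}}{4\gamma_1}\sqrt N\right)\le3\exp\left(-\min\{2,\gamma_2\}N/8\right).$$
   Context: The smallest singular value of an $N\times n$ matrix $\Gamma$ with $N\ge n$ is $s_n(\Gamma)=\inf_{x\in S^{n-1}}\|\Gamma x\|_2$. The constant $c_{uv}=c\,uv\sqrt{1-v}$, where $c\in(0,1]$ is a fixed absolute constant such that for all $u,v\in(0,1)$, every $m\ge1$, all independent real random variables $\xi_1,\dots,\xi_m$ with $\sup_{\lambda\in\mathbb{R}}\mathbb{P}\{|\xi_i-\lambda|\le u\}\le v$ for each $i$, and every $x\in S^{m-1}$, one has $\sup_{\lambda\in\mathbb{R}}\mathbb{P}\{|\sum_{i=1}^m x_i\xi_i-\lambda|\le c_{uv}\}\le v$ (such a $c$ exists by a theorem of Rogozin). The constants $\gamma_1=\gamma_1(v)$, $\gamma_2=\gamma_2(v)$: if $v\ge1/2$, $\gamma_1=\sqrt{\ln2}$ and $\gamma_2=\ln\frac{2}{1+v}$; if $v<1/2$,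 $\gamma_1=\sqrt{\ln\frac1v}$ and $\gamma_2=\ln\frac{1}{2v-v^2}$. *)

(* Defs.v *)
From mathcomp Require Import all_boot all_order all_algebra.
From mathcomp Require Import all_classical all_reals all_analysis.

Set Implicit Arguments.
Unset Strict Implicit.
Unset Printing Implicit Defensive.

Import Order.TTheory GRing.Theory Num.Theory.
Import numFieldNormedType.Exports.

Local Open Scope classical_set_scope.
Local Open Scope ring_scope.

(* The norm that MathComp-Analysis puts on matrices is the sup norm. *)
Definition l2norm (R : realType) (n : nat) (x : 'cV[R]_n) : R :=
  Num.sqrt (\sum_(i < n) x i ord0 ^+ 2).

Definition sphere (R : realType) (n : nat) : set 'cV[R]_n :=
  [set x | l2norm x = 1].

Definition smallest_singular_value (R : realType) (N n : nat)
    (A : 'M[R]_(N, n)) : R :=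
  inf [set l2norm (A *m x) | x in @sphere R n].

Section RandomVariables.
Context d (T : measurableType d) (R : realType) (P : probability T R).

Definition mutually_independent (I : finType) (X : I -> {RV P >-> R}) : Prop :=
  forall (J : {set I}) (A : I -> set R), (forall i, measurable (A i)) ->
    P (\bigcap_(i in [set` J]) (X i @^-1` A i)) =
    (\prod_(i in J) P (X i @^-1` A i))%E.

Definition same_distribution (X Y : T -> R) : Prop :=
  forall A : set R, measurable A -> pushforward P X A = pushforward P Y A.

Definition symmetric_rv (X : T -> R) : Prop :=
  same_distribution X (fun w => - X w).

Definition concentration (X : T -> R) (u : R) : \bar R :=
  ereal_sup [set P [set w | `|X w - lambda| <= u] | lambda in [set: R]].

Definition random_matrix (N n : nat) (xi : 'I_N -> 'I_n -> {RV P >-> R})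
    (w : T) : 'M[R]_(N, n) :=
  \matrix_(i < N, j < n) xi i j w.

End RandomVariables.

Definition c_uv (R : realType) (c u v : R) : R :=
  c * u * v * Num.sqrt (1 - v).

(* The property defining the absolute constant c. *)
Definition rogozin_constant (R : realType) (c : R) : Prop :=
  [/\ 0 < c, c <= 1 &
    forall u v : R, 0 < u < 1 -> 0 < v < 1 ->
    forall (d : measure_display) (T : measurableType d) (P : probability T R)
      (m : nat) (xi : 'I_m -> {RV P >-> R}),
      (1 <= m)%N ->
      mutually_independent xi ->
      (forall i, (concentration P (xi i) u <= v%:E)%E) ->
      forall x : 'cV[R]_m, sphere x ->
      (concentration P (fun w => (\sum_(i < m) x i ord0 * xi i w)%R)
         (c_uv c u v) <= v%:E)%E].

Definition gamma1 (R : realType) (v : R) : R :=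
  if 1 / 2 <= v then Num.sqrt (ln 2) else Num.sqrt (ln (1 / v)).

Definition gamma2 (R : realType) (v : R) : R :=
  if 1 / 2 <= v then ln (2 / (1 + v)) else ln (1 / (2 * v - v ^+ 2)).

(* Main.v *)
Require Import Defs.
From HB Require Import structures.
From mathcomp Require Import all_boot all_order all_algebra.
From mathcomp Require Import all_classical all_reals all_analysis.
From mathcomp Require Import measurable_realfun ring lra.
Import Order.TTheory GRing.Theory Num.Theory.
Import numFieldNormedType.Exports.
Local Open Scope classical_set_scope.
Local Open Scope ring_scope.
Set Implicit Arguments.
Unset Strict Implicit.
Unset Printing Implicit Defensive.

(** Only second moments are available, so the operator norm of [Gamma] is not controlled and a
fixed net of the sphere does not work.  Write [W_j] for the squared norm of the [j]-th column
divided by [N].  The [W_j] are independent with mean 1, so [prod_j (1 + W_j)] has expectation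
[2^n] and, outside an event of probability [e^(-K)] with [K = min(2, gamma2) N / 8], it is less
than [2^n e^K].  On that event a unit vector [x] is rounded, coordinate by coordinate, to a
lattice whose [j]-th spacing is [eps / (2^(k_j) sqrt n)] with [4^(k_j) <= 1 + W_j < 4^(k_j + 1)];
a greedy choice of the roundings produces [y] with [|Gamma (x - y)| <= eps sqrt N] (this is the
derandomized form of Livshyts' random rounding).  Since [4^(sum k_j) <= 2^n e^K], all the
lattice points that can occur number at most [2^n e^K (8 e rho)^n], [rho = (1 + eps) / eps].
For a fixed direction, Rogozin's theorem and a Chernoff bound on the number of small
coordinates of [Gamma y] give the probability [exp (- 3 gamma2 N / 4)].  With
[eps = c_uv^2 / 32] the size of the net is polynomial in [1 / c_uv] to the power [n], and the
union bound concludes. *)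

(** * Independence of sigma-algebras *)

Section Independence.
Context d (T : measurableType d) (R : realType) (P : probability T R).
Local Open Scope ereal_scope.

(** The pi-lambda theorem: the events independent of [D] form a Dynkin system, and this one contains
    the pi-system [G]. *)
Lemma independent_sigma_algebra (G : set (set T)) (D B : set T) :
  setI_closed G -> G `<=` measurable -> measurable D ->
  (forall C, G C -> P (D `&` C) = P D * P C) ->
  <<s G >> B -> P (D `&` B) = P D * P B.
Proof.
move=> GI mG mD GE sB.
suff : <<s G >> `<=` [set C | measurable C /\ P (D `&` C) = P D * P C].
  by move=> /(_ _ sB)[].
apply: lambda_system_subset => //; last by move=> C GC; split; [exact: mG|exact: GE].
apply/dynkin_lambda_system; split.
- by split => //; rewrite setIT probability_setT mule1.
- move=> C [mC CE]; split; first exact: measurableC.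
  rewrite -setDE probability_setC// measureD// ?(le_lt_trans (probability_le1 P mD)) ?ltry//.
  by rewrite [X in _ - X](_ : _ = P D * P C)// muleBr ?fin_num_measure ?mule1.
- move=> F tF FE; split.
    by apply: bigcup_measurable => k _; have [] := FE k.
  rewrite setI_bigcupr measure_bigcup//=; last 2 first.
  + by move=> i _; apply: measurableI => //; have [] := FE i.
  + exact: trivIset_setIl.
  rewrite measure_bigcup//; last by move=> i _; have [] := FE i.
  have -> : P D = (fine (P D))%:E by rewrite fineK// fin_num_measure.
  rewrite -nneseriesZl//; apply: eq_eseriesr => i _.
  by rewrite fineK ?fin_num_measure//; have [] := FE i.
Qed.

Variables (I : finType) (X : I -> {RV P >-> R}).

(** A pi-system generating the sigma-algebra of the variables [X i] with [i \in S]. The family [A]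
    is indexed by all of [I] to avoid a dependent type. *)
Definition cylinders (S : {pred I}) : set (set T) :=
  [set B | exists2 A : I -> set R, forall i, measurable (A i) &
    B = \bigcap_(i in [set` S]) (X i @^-1` A i)].

Lemma measurable_cylinders S : cylinders S `<=` measurable.
Proof.
move=> _ [A mA ->]; apply: fin_bigcap_measurable; first exact: finite_finset.
by move=> i _; rewrite -[_ @^-1` _]setTI; exact: measurable_funPT.
Qed.

Lemma cylinders_setT S : cylinders S setT.
Proof. by exists (fun=> setT) => //; rewrite bigcapT. Qed.

Lemma cylinders_setI S : setI_closed (cylinders S).
Proof.
move=> _ _ [A mA ->] [B mB ->]; exists (fun i => A i `&` B i).
  by move=> i; exact: measurableI.
by rewrite -bigcapI; apply: eq_bigcapr => i _; rewrite preimage_setI.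
Qed.

Lemma sigma_cylinders_measurable S : <<s cylinders S >> `<=` measurable.
Proof.
apply: smallest_sub; last exact: measurable_cylinders.
exact: sigma_algebra_measurable.
Qed.

(** Cylinders are upgraded to arbitrary events of the block sigma-algebras, one fibre of [h] at a
    time. It serves with matrix rows as blocks, and with one variable split off from the others. *)
Lemma grouped_independence (K : finType) (h : I -> K) (B : K -> set T) :
  mutually_independent X ->
  (forall k, <<s cylinders [pred i | h i == k] >> (B k)) ->
  P (\bigcap_(k in [set: K]) B k) = \prod_k P (B k).
Proof.
move=> indX sB.
pose G k := cylinders [pred i | h i == k].
(* [J] collects the blocks whose event is arbitrary; all others carry cylinders. The induction is on
   its size. *)
suff H m : forall (J : {set K}) (C : K -> set T), #|J| = m ->
    (forall k, k \in J -> <<s G k >> (C k)) -> (forall k, k \notin J -> G k (C k)) ->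
    P (\bigcap_(k in [set: K]) C k) = \prod_k P (C k).
  apply: (H _ [set: K]%SET B erefl) => k; first by move=> _; exact: sB.
  by rewrite inE.
elim: m => [|m IH] J C.
  move=> /cards0_eq -> _ GC.
  have /choice[A AE] : forall k, exists A : I -> set R, (forall i, measurable (A i)) /\
      C k = \bigcap_(i in [set i | h i == k]) (X i @^-1` A i).
    by move=> k; have [|A mA AE] := GC k; [rewrite inE|exists A].
  have CE k : P (C k) = \prod_(i | h i == k) P (X i @^-1` A k i).
    have [mA ->] := AE k.
    rewrite (_ : [set i | h i == k] = [set` [set i | h i == k]%SET]); last first.
      by apply/seteqP; split => i /=; rewrite inE.
    rewrite indX; first by apply: eq_bigl => i; rewrite inE.
    by move=> i; exact: mA.
  (* With a cylinder in every block, the intersection is one cylinder over [I], with the set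
     [A (h i) i] at index [i]. *)
  rewrite (_ : \bigcap_(k in _) C k =
     \bigcap_(i in [set` [set: I]%SET]) (X i @^-1` A (h i) i)); last first.
    apply/seteqP; split => w /= Hw.
      move=> i _; have := Hw (h i) Logic.I; rewrite (AE (h i)).2 => /(_ i); apply.
      by rewrite /= eqxx.
    move=> k _; rewrite (AE k).2 => i /= /eqP <-; apply: Hw => /=.
    by rewrite inE.
  rewrite indX; last by move=> i; exact: (AE (h i)).1.
  rewrite (partition_big h xpredT)//=; apply: eq_bigr => k _.
  rewrite CE; apply: eq_big => [i|i]; first by rewrite inE.
  by rewrite inE => /eqP ->.
move=> Jm sC GC.
have /card_gt0P[k0 k0J] : (0 < #|J|)%N by rewrite Jm.
have mC k : measurable (C k).
  have [kJ|kJ] := boolP (k \in J).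
    by apply: (@sigma_cylinders_measurable [pred i | h i == k]); exact: sC.
  by apply: (@measurable_cylinders [pred i | h i == k]); exact: GC.
pose D := \bigcap_(k in [set k | k != k0]) C k.
have mD : measurable D.
  by apply: fin_bigcap_measurable => //; exact: finite_finset.
(* Putting a cylinder [E] at [k0] lowers the size of [J], so [D] is independent of the generating
   pi-system of that block. *)
have IHD E : G k0 E -> P (D `&` E) = (\prod_(k | k != k0) P (C k)) * P E.
  move=> GE; pose C' k := if k == k0 then E else C k.
  have := IH (J :\ k0)%SET C'.
  rewrite (_ : \bigcap_(k in _) C' k = D `&` E); last first.
    apply/seteqP; split => [w /= Hw|w [Dw Ew] k _].
      split; last by have := Hw k0 Logic.I; rewrite /C' eqxx.
      by move=> k /= kk0; have := Hw k Logic.I; rewrite /C' (negbTE kk0).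
    by rewrite /C'; case: (eqVneq k k0) => // /Dw.
  move=> -> //.
  - rewrite (bigD1 k0)//= muleC; congr (_ * _); last by rewrite /C' eqxx.
    by apply: eq_bigr => k /negbTE kk0; rewrite /C' kk0.
  - by move: Jm; rewrite (cardsD1 k0) k0J => -[].
  - by move=> k; rewrite !inE /C'; case: eqP => //= _; exact: sC.
  - by move=> k; rewrite !inE /C'; case: eqP => [->//|_] /=; exact: GC.
have PD : P D = \prod_(k | k != k0) P (C k).
  by have := IHD setT (cylinders_setT _); rewrite setIT probability_setT mule1.
rewrite (_ : \bigcap_(k in _) C k = D `&` C k0); last first.
  apply/seteqP; split => [w /= Hw|w [Dw Ew] k _].
    by split; [move=> k /= _; exact: Hw|exact: Hw].
  by have [->//|kk0] := eqVneq k k0; exact: Dw.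
rewrite (@independent_sigma_algebra (G k0))//.
- by rewrite PD [RHS](bigD1 k0)//= muleC.
- exact: cylinders_setI.
- exact: measurable_cylinders.
- by move=> E GE; rewrite IHD// PD.
- exact: sC.
Qed.

Lemma measurable_coordinate (S : {pred I}) i : i \in S ->
  measurable_fun setT (X i : g_sigma_algebraType (cylinders S) -> R).
Proof.
move=> iS _ A mA; rewrite setTI; apply: sub_sigma_algebra.
exists (fun j => if j == i then A else setT); first by move=> j; case: ifP.
apply/seteqP; split => w /= Hw.
  by move=> j _ /=; case: eqP => [->|].
by have := Hw i iS; rewrite /= eqxx.
Qed.

End Independence.

(** * Expectations of products of independent nonnegative variables *)

Section IndependentProduct.
Context d (T : measurableType d) (R : realType) (P : probability T R).
Local Open Scope ereal_scope.

Lemma independent_integralM (U V : {RV P >-> R}) :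
  (forall w, 0 <= U w)%R -> (forall w, 0 <= V w)%R ->
  (forall A B, measurable A -> measurable B ->
    P (U @^-1` A `&` V @^-1` B) = P (U @^-1` A) * P (V @^-1` B)) ->
  \int[P]_w (U w * V w)%:E = \int[P]_w (U w)%:E * \int[P]_w (V w)%:E.
Proof.
move=> U0 V0 UV.
have mW : measurable_fun setT (fun w => (U w, V w)).
  exact: measurable_fun_pair.
pose W : {mfun T >-> (R * R)%type} :=
  HB.pack (fun w => (U w, V w)) (isMeasurableFun.Build _ _ _ _ _ mW).
(* Absolute values make [f] nonnegative on the whole plane, as Tonelli requires; they change nothing
   at the values of [U] and [V]. *)
pose f (z : R * R) : \bar R := (`|z.1| * `|z.2|)%:E.
have mf : measurable_fun setT f.
  apply/measurable_EFinP; apply: measurable_funM; apply: measurableT_comp => //.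
have f0 z : 0 <= f z by rewrite lee_fin mulr_ge0.
transitivity (\int[P]_w (f \o W) w).
  by apply: eq_integral => w _; rewrite /f /= !ger0_norm.
rewrite -(ge0_integral_distribution W)//.
(* By uniqueness of the product measure, the joint law is the product of the marginals. *)
rewrite (@eq_measure_integral _ _ _ _ (distribution P U \x distribution P V)); last first.
  by move=> A mA _; apply/esym/product_measure_unique.
rewrite fubini_tonelli1//.
transitivity (\int[distribution P U]_x (`|x|%:E * \int[P]_w (V w)%:E)).
  apply: eq_integral => x _; rewrite /fubini_F/= /f/=.
  under eq_integral do rewrite EFinM.
  rewrite ge0_integralZl//; last first.
    by apply/measurable_EFinP; exact: normr_measurable.
  congr (_ * _); rewrite (ge0_integral_distribution V)//=.
    by apply: eq_integral => w _ /=; rewrite ger0_norm.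
  by apply/measurable_EFinP; exact: normr_measurable.
rewrite ge0_integralZr//; last first.
- by apply: integral_ge0 => w _; rewrite lee_fin.
- by apply/measurable_EFinP; exact: normr_measurable.
congr (_ * _); rewrite (ge0_integral_distribution U)//=.
  by apply: eq_integral => w _ /=; rewrite ger0_norm.
by apply/measurable_EFinP; exact: normr_measurable.
Qed.

Lemma independent_integral_prod (I : finType) (X : I -> {RV P >-> R})
    (f : I -> R -> R) (J : seq I) :
  mutually_independent X -> uniq J ->
  (forall i, measurable_fun setT (f i)) -> (forall i x, 0 <= f i x)%R ->
  \int[P]_w (\prod_(i <- J) f i (X i w))%:E = \prod_(i <- J) \int[P]_w (f i (X i w))%:E.
Proof.
move=> indX + mf f0; elim: J => [_|k J IH /= /andP[kJ uJ]].
  rewrite big_nil; under eq_integral do rewrite big_nil.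
  by rewrite integral_cst// mul1e; exact: probability_setT.
rewrite big_cons -IH//; under eq_integral do rewrite big_cons.
have mU : measurable_fun setT (fun w => f k (X k w)) by exact: measurableT_comp.
have mV : measurable_fun setT (fun w => \prod_(i <- J) f i (X i w))%R.
  by apply: measurable_prod => i _; exact: measurableT_comp.
pose U : {RV P >-> R} := HB.pack (fun w => f k (X k w)) (isMeasurableFun.Build _ _ _ _ _ mU).
pose V : {RV P >-> R} := HB.pack (fun w => \prod_(i <- J) f i (X i w))%R
  (isMeasurableFun.Build _ _ _ _ _ mV).
apply: (@independent_integralM U V) => [w|w|A B mA mB] /=.
- exact: f0.
- by apply: prodr_ge0.
pose h i := i == k.
pose C (b : bool) := if b then U @^-1` A else V @^-1` B.
have := @grouped_independence _ _ _ P _ X _ h C indX.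
rewrite !big_bool/=.
rewrite (_ : \bigcap_(k in _) C k = U @^-1` A `&` V @^-1` B); last first.
  apply/seteqP; split => w; first by move=> H; split; [exact: (H true)|exact: (H false)].
  by move=> [? ?] [].
apply => -[]; rewrite /C.
- set G := cylinders _ _; rewrite -[U @^-1` A]setTI.
  have : measurable_fun setT (U : g_sigma_algebraType G -> R).
    by apply: measurableT_comp => //; apply: measurable_coordinate; rewrite inE /h eqxx.
  by apply.
- set G := cylinders _ _; rewrite -[V @^-1` B]setTI.
  have : measurable_fun setT (V : g_sigma_algebraType G -> R).
    rewrite /V/=.
    (* Every remaining factor must be measurable for the block without [k]. As [k] is not in [J],
       writing 1 at [k] changes nothing. *)
    rewrite (_ : (fun _ => _) = (fun w => \prod_(i <- J) (if i == k then 1 else f i (X i w)))%R).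
      apply: measurable_prod => i iJ; case: eqP => [//|/eqP ik].
      by apply: measurableT_comp => //; apply: measurable_coordinate; rewrite inE /h eqbF_neg.
    apply/funext => w; apply: eq_big_seq => i iJ; case: eqP => // ik.
    by rewrite -ik iJ in kJ.
  by apply.
Qed.

End IndependentProduct.

(** * Column norms *)

Section ColumnNorms.
Context d (T : measurableType d) (R : realType) (P : probability T R).
Local Open Scope ereal_scope.

(* No integrability is needed: the positive and negative parts have the same
   integral, and [fine] sends their difference to [0] even when both are [+oo]. *)
Lemma symmetric_expectation (X : {RV P >-> R}) :
  symmetric_rv P X -> fine 'E_P[X] = 0%R.
Proof.
move=> symX.
have mY : measurable_fun setT (fun w => - X w)%R by exact: measurable_funN.
pose Y : {RV P >-> R} := HB.pack (fun w => - X w)%R (isMeasurableFun.Build _ _ _ _ _ mY).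
have mg : measurable_fun setT (EFin : R -> \bar R)^\+.
  by apply: measurable_funepos; apply/measurable_EFinP.
have H : \int[P]_w (EFin \o X)^\+ w = \int[P]_w (EFin \o X)^\- w.
  transitivity (\int[distribution P X]_x (EFin : R -> \bar R)^\+ x).
    rewrite (ge0_integral_distribution X)//.
    by apply: eq_integral => w _; rewrite /= !funeposE.
  transitivity (\int[distribution P Y]_x (EFin : R -> \bar R)^\+ x).
    by apply: eq_measure_integral => A mA _; exact: symX.
  rewrite (ge0_integral_distribution Y)//.
  by apply: eq_integral => w _; rewrite /= funeposE funenegE.
rewrite unlock integralE H; set a := integral _ _ _.
by case: a => [r| |]//=; rewrite subrr.
Qed.

Lemma symmetric_second_moment (X : {RV P >-> R}) :
  symmetric_rv P X -> 'V_P[X] = 1 -> \int[P]_w (X w ^+ 2)%:E = 1.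
Proof.
move=> symX; rewrite /variance unlock symmetric_expectation// unlock => <-.
by apply: eq_integral => w _; rewrite -[in LHS](subr0 (X w)) expr2.
Qed.

(** Expanding the product over columns gives [N ^ n] terms, one for each choice [f] of a row per
    column. The chosen entries are distinct, hence independent, so each term has expectation
    [(2 / N) ^ n]. *)
Lemma expectation_prod_column_norms (N n : nat) (xi : 'I_N -> 'I_n -> {RV P >-> R}) :
  (0 < N)%N -> mutually_independent (fun ij : 'I_N * 'I_n => xi ij.1 ij.2) ->
  (forall i j, \int[P]_w (xi i j w ^+ 2)%:E = 1) ->
  \int[P]_w (\prod_(j < n) (1 + (\sum_(i < N) xi i j w ^+ 2) / N%:R))%:E = (2 ^+ n)%:E.
Proof.
move=> N0 indxi xi2.
have N0' : (N%:R != 0 :> R)%R by rewrite pnatr_eq0 -lt0n.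
(* The summand 1 is spread over the [N] rows, so that column [j] contributes
   [\sum_i g (xi i j w)]. *)
pose g (x : R) : R := (N%:R^-1 * (1 + x ^+ 2))%R.
have mg : measurable_fun setT g.
  by apply: measurable_funM => //; apply: measurable_funD => //; exact: measurable_funX.
have g0 x : (0 <= g x)%R by rewrite mulr_ge0// addr_ge0// sqr_ge0.
transitivity (\int[P]_w (\sum_(f : {ffun 'I_n -> 'I_N}) (\prod_(j < n) g (xi (f j) j w))%:E)).
  apply: eq_integral => w _; rewrite sumEFin; congr (_%:E).
  rewrite -(bigA_distr_bigA (fun j i => g (xi i j w))).
  apply: eq_bigr => j _; rewrite -mulr_sumr big_split/= sumr_const card_ord.
  by rewrite mulrDr mulVf// mulrC.
rewrite ge0_integral_sum//; last 2 first.
- move=> f; apply/measurable_EFinP; apply: measurable_prod => j _.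
  exact: measurableT_comp.
- by move=> f w _; rewrite lee_fin; apply: prodr_ge0.
have gE i j : \int[P]_w (g (xi i j w))%:E = (2 / N%:R)%:E.
  rewrite /g; under eq_integral do rewrite EFinM EFinD.
  rewrite ge0_integralZl//; last 2 first.
  - apply: emeasurable_funD => //; apply/measurable_EFinP; exact: measurable_funX.
  - by move=> w _; rewrite adde_ge0// lee_fin sqr_ge0.
  rewrite ge0_integralD//; last 2 first.
  - by move=> w _; rewrite lee_fin sqr_ge0.
  - by apply/measurable_EFinP; exact: measurable_funX.
  rewrite xi2 (_ : \int[P]_x 1 = 1); first by rewrite -EFinD -EFinM mulrC.
  by rewrite integral_cst// mul1e; exact: probability_setT.
transitivity (\sum_(f : {ffun 'I_n -> 'I_N}) ((2 / N%:R) ^+ n : R)%:E).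
  apply: eq_bigr => f _.
  pose J := [seq (f j, j) | j <- enum 'I_n].
  transitivity (\int[P]_w (\prod_(ij <- J) g (xi ij.1 ij.2 w))%:E).
    by apply: eq_integral => w _; rewrite big_map big_enum.
  rewrite (independent_integral_prod (f := fun=> g) indxi)//; last first.
    by rewrite map_inj_uniq ?enum_uniq// => i j [].
  rewrite big_map big_enum/=.
  under eq_bigr do rewrite gE.
  by rewrite prodEFin prodr_const card_ord.
rewrite sumEFin sumr_const card_ffun !card_ord -[X in X%:E]mulr_natr natrX.
by rewrite expr_div_n mulfVK// expf_neq0.
Qed.

Lemma measurable_prod_column_norms (N n : nat) (xi : 'I_N -> 'I_n -> {RV P >-> R}) :
  measurable_fun setT (fun w => \prod_(j < n) (1 + (\sum_(i < N) xi i j w ^+ 2) / N%:R))%R.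
Proof.
apply: measurable_prod => j _; apply: measurable_funD => //; apply: measurable_funM => //.
by apply: measurable_sum => i; exact: measurable_funX.
Qed.

(** Markov's inequality, applied to a product whose expectation is [2 ^+ n]. *)
Lemma column_norms_tail (N n : nat) (xi : 'I_N -> 'I_n -> {RV P >-> R}) (K : R) :
  (0 < N)%N -> mutually_independent (fun ij : 'I_N * 'I_n => xi ij.1 ij.2) ->
  (forall i j, \int[P]_w (xi i j w ^+ 2)%:E = 1) ->
  P [set w | 2 ^+ n * expR K <=
      \prod_(j < n) (1 + (\sum_(i < N) xi i j w ^+ 2) / N%:R)]%R <= (expR (- K))%:E.
Proof.
move=> N0 indxi xi2.
pose G w : R := (\prod_(j < n) (1 + (\sum_(i < N) xi i j w ^+ 2) / N%:R))%R.
have G0 w : (0 <= G w)%R.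
  by apply: prodr_ge0 => j _; rewrite addr_ge0// divr_ge0// sumr_ge0// => i _; rewrite sqr_ge0.
have mG : measurable_fun setT G by exact: measurable_prod_column_norms.
pose F : {RV P >-> R} := HB.pack G (isMeasurableFun.Build _ _ _ _ _ mG).
have e0 : (0 < 2 ^+ n * expR K :> R)%R by rewrite mulr_gt0 ?exprn_gt0 ?expR_gt0.
have := @markov _ _ _ P F id _ e0 (@measurable_id _ _ _) (fun _ => id) (fun _ _ _ _ => id).
rewrite unlock /=.
under eq_integral do rewrite ger0_norm//.
rewrite expectation_prod_column_norms//.
under eq_set do rewrite ger0_norm// lee_fin.
rewrite EFinM -muleA => H.
have : (2 ^+ n)%:E * ((expR K)%:E * P [set w | 2 ^+ n * expR K <=
      \prod_(j < n) (1 + (\sum_(i < N) xi i j w ^+ 2) / N%:R)]%R) <= (2 ^+ n)%:E * 1.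
  by rewrite mule1.
rewrite lee_pmul2l ?lte_fin ?exprn_gt0// => {}H.
by rewrite expRN -[X in _ <= X]mule1 lee_pdivlMl ?expR_gt0.
Qed.

End ColumnNorms.

(** * Small ball probability of a fixed vector *)

Section SmallBall.
Context d (T : measurableType d) (R : realType) (P : probability T R).
Local Open Scope ereal_scope.

Lemma mutually_independent_inj (I J : finType) (X : I -> {RV P >-> R}) (e : J -> I) :
  injective e -> mutually_independent X -> mutually_independent (X \o e).
Proof.
move=> einj indX S A mA.
pose A' i := if [pick j | e j == i] is Some j then A j else setT.
have A'E j : A' (e j) = A j.
  rewrite /A'; case: pickP => [k /eqP /einj -> //|/(_ j)].
  by rewrite eqxx.
have := indX [set e j | j in S]%SET A'.
rewrite big_imset/=; last by move=> i j _ _; exact: einj.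
under eq_bigr do rewrite A'E.
move=> <-; last by move=> i; rewrite /A'; case: pickP.
congr (P _); apply/seteqP; split => w /= Hw.
  by move=> i /= /imsetP[j jS ->]; rewrite A'E; exact: Hw.
by move=> j /= jS; rewrite -A'E; apply: Hw => /=; apply: imset_f.
Qed.

Lemma union_bound (I : choiceType) (s : seq I) (A : I -> set T) (E : set T) :
  measurable E -> (forall i, measurable (A i)) ->
  (forall w, E w -> exists2 i, i \in s & A i w) ->
  P E <= \sum_(i <- s) P (A i).
Proof.
move=> mE mA EA.
have mU s' : measurable (\big[setU/set0]_(i <- s') A i) by exact: bigsetU_measurable.
apply: (@le_trans _ _ (P (\big[setU/set0]_(i <- s) A i))).
  apply: le_measure; rewrite ?inE// => w /EA[i si Aiw].
  by rewrite -bigcup_seq; exists i.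
elim: s {EA} => [|i s IH]; first by rewrite !big_nil measure0.
rewrite !big_cons (le_trans (measureU2 _ _ _))//.
by rewrite leeD2l.
Qed.

(** Chernoff's bound for the number of [i] at which [A i] fails. The patterns [S] of failures with
    [#|S| <= m] get the weight [expR (L * (m - #|S|))], which is at least 1; the weighted sum over
    all [S] factorizes. *)
Lemma independent_count_tail (I : finType) (A : I -> set T) (v L m : R) :
  (0 <= L)%R -> (forall i, measurable (A i)) -> (forall i, P (A i) <= v%:E) ->
  (forall S : {set I}, P (\bigcap_(i in [set: I]) (if i \in S then ~` A i else A i))
     = \prod_i P (if i \in S then ~` A i else A i)) ->
  forall E : set T, measurable E ->
  (forall w, E w -> \sum_(i : I) (if w \in A i then 0 else 1) <= m)%R ->
  P E <= (expR (L * m) * (v + (1 - v) * expR (- L)) ^+ #|I|)%:E.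
Proof.
move=> L0 mA Av indA E mE EA.
pose p i := fine (P (A i)).
have pE i : P (A i) = (p i)%:E by rewrite fineK// fin_num_measure.
have p0 i : (0 <= p i)%R by rewrite fine_ge0.
have p1 i : (p i <= 1)%R by rewrite -lee_fin -pE probability_le1.
have pC i : P (~` A i) = (1 - p i)%:E by rewrite probability_setC// pE.
pose C (S : {set I}) i := if i \in S then ~` A i else A i.
have mC S i : measurable (C S i) by rewrite /C; case: ifP => // _; exact: measurableC.
have mD S : measurable (\bigcap_(i in [set: I]) C S i).
  by apply: fin_bigcap_measurable => //; exact: finite_finset.
have PC S : P (\bigcap_(i in [set: I]) C S i) =
    (\prod_i (if i \in S then 1 - p i else p i)%R)%:E.
  rewrite indA -prodEFin; apply: eq_bigr => i _.
  by case: ifP => _; rewrite ?pC ?pE.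
pose s := [seq S : {set I} <- index_enum _ | (#|S|%:R <= m)%R].
have := @union_bound _ s (fun S => \bigcap_(i in [set: I]) C S i) E mE mD.
move=> H; apply: (le_trans (H _)).
  move=> w Ew; exists [set i | w \notin A i]%SET.
    rewrite mem_filter mem_index_enum andbT (le_trans _ (EA _ Ew))//.
    rewrite -sum1_card natr_sum big_mkcond/=; apply: ler_sum => i _.
    by rewrite inE; case: (w \in A i).
  by move=> i _; rewrite /C inE; have [|] := boolP (w \in A i) => /=; rewrite ?inE ?notin_setE.
rewrite /s big_filter; under eq_bigr do rewrite PC.
rewrite sumEFin lee_fin.
apply: (@le_trans _ _ (\sum_(S : {set I}) expR (L * m) *
   \prod_i (if i \in S then (1 - p i) * expR (- L) else p i))%R).
  rewrite big_mkcond/=; apply: ler_sum => S _.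
  have prod0 : (0 <= \prod_i (if i \in S then 1 - p i else p i))%R.
    by apply: prodr_ge0 => i _; case: ifP => _ //; rewrite subr_ge0.
  have -> : (\prod_i (if i \in S then (1 - p i) * expR (- L) else p i) =
     expR (- L * #|S|%:R) * \prod_i (if i \in S then 1 - p i else p i))%R.
    rewrite [(- L * _)%R]mulrC expRM_natl -prodr_const [in RHS]big_mkcond/= -big_split/=.
    by apply: eq_bigr => i _; case: ifP => _; rewrite ?mul1r// mulrC.
  rewrite mulrA -expRD mulNr -mulrBr; case: ifP => Sm; last first.
    by rewrite mulr_ge0 ?expR_ge0.
  by rewrite ler_peMl// -[X in (X <= _)%R]expR0 ler_expR mulr_ge0// subr_ge0.
rewrite -mulr_sumr ler_wpM2l ?expR_ge0// -bigA_distr.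
rewrite -prodr_const; apply: ler_prod => i _.
have eL1 : (expR (- L) <= 1)%R by rewrite -expR0 ler_expR oppr_le0.
have pv : (p i <= v)%R by rewrite -lee_fin -pE.
rewrite addr_ge0 ?mulr_ge0 ?subr_ge0 ?expR_ge0//=.
(* Each factor is affine and nondecreasing in [p i], so [v] may replace [p i]. *)
have : (0 <= (v - p i) * (1 - expR (- L)))%R by rewrite mulr_ge0// subr_ge0.
by lra.
Qed.

Lemma random_matrix_mulE N n (xi : 'I_N -> 'I_n -> {RV P >-> R}) (x : 'cV[R]_n) i w :
  ((random_matrix xi w *m x) i ord0 = \sum_(j < n) x j ord0 * xi i j w)%R.
Proof. by rewrite !mxE; apply: eq_bigr => j _; rewrite mxE mulrC. Qed.

Lemma measurable_l2norm_random_matrix N n (xi : 'I_N -> 'I_n -> {RV P >-> R}) (x : 'cV[R]_n) :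
  measurable_fun setT (fun w => l2norm (random_matrix xi w *m x)).
Proof.
apply: (measurableT_comp (continuous_measurable_fun (@sqrt_continuous R))).
apply: measurable_sum => i; apply: measurable_funX.
under eq_fun do rewrite random_matrix_mulE.
by apply: measurable_sum => j; exact: measurable_funM.
Qed.

Lemma measurable_l2norm_le N n (xi : 'I_N -> 'I_n -> {RV P >-> R}) (x : 'cV[R]_n) (r : R) :
  measurable [set w | l2norm (random_matrix xi w *m x) <= r]%R.
Proof.
rewrite (_ : [set w | _] = (fun w => l2norm (random_matrix xi w *m x)) @^-1` `]-oo, r]%classic).
  by rewrite -[X in measurable X]setTI; apply: measurable_l2norm_random_matrix.
by apply/seteqP; split => w; rewrite /= in_itv.
Qed.

(** A vector of norm at most [s] has at most [(s / a) ^+ 2] coordinates of absolute value above [a].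
    The rows are independent, so the Chernoff bound applies to the count of such coordinates. *)
Lemma small_ball N n (xi : 'I_N -> 'I_n -> {RV P >-> R}) (x : 'cV[R]_n)
    (a v L s : R) (E : set T) :
  mutually_independent (fun ij : 'I_N * 'I_n => xi ij.1 ij.2) ->
  (0 < a)%R -> (0 <= L)%R ->
  (forall i, concentration P (fun w => \sum_(j < n) x j ord0 * xi i j w)%R a <= v%:E) ->
  measurable E -> (forall w, E w -> l2norm (random_matrix xi w *m x) <= s)%R ->
  P E <= (expR (L * (s / a) ^+ 2) * (v + (1 - v) * expR (- L)) ^+ N)%:E.
Proof.
move=> indxi a0 L0 conc mE Es.
pose Y i w : R := (\sum_(j < n) x j ord0 * xi i j w)%R.
pose I := [set y : R | `|y| <= a]%R.
have mI : measurable I.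
  rewrite (_ : I = Num.norm @^-1` `]-oo, a]%classic); last first.
    by apply/seteqP; split => y /=; rewrite in_itv.
  by rewrite -[X in measurable X]setTI; exact: normr_measurable.
pose X (ij : 'I_N * 'I_n) := xi ij.1 ij.2.
have mY i : measurable_fun setT
    (Y i : g_sigma_algebraType (cylinders X [pred ij | ij.1 == i]) -> R).
  apply: measurable_sum => j; apply: measurable_funM => //.
  by apply: (@measurable_coordinate _ _ _ _ _ X _ (i, j)); rewrite inE/= eqxx.
have sA i (b : bool) : <<s cylinders X [pred ij | ij.1 == i] >>
    (if b then ~` (Y i @^-1` I) else Y i @^-1` I).
  case: b; rewrite ?preimage_setC -[_ @^-1` _]setTI.
    exact: (mY i measurableT _ (measurableC mI)).
  exact: (mY i measurableT _ mI).
have mA i : measurable (Y i @^-1` I).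
  exact: (@sigma_cylinders_measurable _ _ _ _ _ X _ _ (sA i false)).
have := @independent_count_tail 'I_N (fun i => Y i @^-1` I) v L ((s / a) ^+ 2) L0 mA.
rewrite card_ord; apply => //.
- move=> i; apply: le_trans (conc i); apply: ereal_sup_ubound; exists 0%R => //.
  by congr (P _); apply/seteqP; split => w; rewrite /I /= subr0.
- by move=> S; exact: (grouped_independence indxi (h := fst)).
- move=> w /Es; rewrite /l2norm => Hs.
  have s0 : (0 <= s)%R by exact: le_trans Hs.
  rewrite expr_div_n ler_pdivlMr ?exprn_gt0// mulr_suml.
  rewrite -(@ler_sqrt _ _ (s ^+ 2)%R) ?sqr_ge0// sqrtr_sqr ger0_norm//.
  apply: le_trans Hs; rewrite ler_sqrt; last by apply: sumr_ge0 => i _; exact: sqr_ge0.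
  apply: ler_sum => i _; rewrite random_matrix_mulE -/(Y i w).
  case: ifPn => [_|]; first by rewrite mul0r sqr_ge0.
  rewrite notin_setE /I /= => /negP; rewrite -ltNge mul1r => aY.
  by rewrite -[leRHS]real_normK ?num_real// ler_pXn2r ?nnegrE// ltW.
Qed.

End SmallBall.

(** * Rounding and nets *)

Section Euclidean.
Context (R : realType).

Lemma l2norm_ge0 n (x : 'cV[R]_n) : 0 <= l2norm x.
Proof. exact: sqrtr_ge0. Qed.

Lemma l2norm_sqr n (x : 'cV[R]_n) : l2norm x ^+ 2 = \sum_(i < n) x i ord0 ^+ 2.
Proof. by rewrite sqr_sqrtr// sumr_ge0// => i _; exact: sqr_ge0. Qed.

Lemma l2norm_le n (x : 'cV[R]_n) (r : R) :
  0 <= r -> (l2norm x <= r) = (\sum_(i < n) x i ord0 ^+ 2 <= r ^+ 2).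
Proof. by move=> r0; rewrite -l2norm_sqr ler_pXn2r ?nnegrE// l2norm_ge0. Qed.

Lemma l2normZ n (x : 'cV[R]_n) (a : R) : l2norm (a *: x) = `|a| * l2norm x.
Proof.
rewrite /l2norm -sqrtr_sqr -sqrtrM ?sqr_ge0// mulr_sumr.
by congr Num.sqrt; apply: eq_bigr => i _; rewrite mxE exprMn.
Qed.

Lemma l2norm_eq0 n (x : 'cV[R]_n) : l2norm x = 0 -> x = 0.
Proof.
move=> x0; apply/matrixP => i j; rewrite !ord1 mxE; apply/eqP; rewrite -sqrf_eq0.
have /eqP := l2norm_sqr x; rewrite x0 expr0n/= eq_sym psumr_eq0.
  by move=> /allP /(_ i); rewrite mem_index_enum => /(_ isT).
by move=> k _; exact: sqr_ge0.
Qed.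

Lemma l2norm_triangle n (x y : 'cV[R]_n) : l2norm (x + y) <= l2norm x + l2norm y.
Proof.
have [x0|x0] := eqVneq (l2norm x) 0; first by rewrite (l2norm_eq0 x0) add0r lerDr l2norm_ge0.
have [y0|y0] := eqVneq (l2norm y) 0; first by rewrite (l2norm_eq0 y0) addr0 lerDl l2norm_ge0.
have {}x0 : 0 < l2norm x by rewrite lt_def x0 l2norm_ge0.
have {}y0 : 0 < l2norm y by rewrite lt_def y0 l2norm_ge0.
set a := l2norm x in x0 *; set b := l2norm y in y0 *.
rewrite l2norm_le; last by rewrite addr_ge0 ?ltW.
(* Young's inequality in each coordinate; these weights make the total exactly [(a + b) ^+ 2]. *)
apply: (@le_trans _ _ (\sum_(i < n) ((1 + b / a) * x i ord0 ^+ 2 + (1 + a / b) * y i ord0 ^+ 2))).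
  apply: ler_sum => i _; rewrite mxE -subr_ge0.
  set s := x i ord0; set t := y i ord0.
  have -> : (1 + b / a) * s ^+ 2 + (1 + a / b) * t ^+ 2 - (s + t) ^+ 2 =
      (b * s - a * t) ^+ 2 / (a * b).
    by field; rewrite !gt_eqF.
  by rewrite divr_ge0 ?sqr_ge0// mulr_ge0// ltW.
rewrite big_split/= -!mulr_sumr -!l2norm_sqr -/a -/b.
suff -> : (1 + b / a) * a ^+ 2 + (1 + a / b) * b ^+ 2 = (a + b) ^+ 2 by [].
by field; rewrite !gt_eqF.
Qed.

Lemma l2norm_sub n (x y : 'cV[R]_n) : l2norm x <= l2norm y + l2norm (x - y).
Proof. by rewrite -[X in l2norm X <= _](subrKC y) l2norm_triangle. Qed.

Lemma l2normB n (x y : 'cV[R]_n) : l2norm (x - y) = l2norm (y - x).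
Proof. by rewrite -opprB -scaleN1r l2normZ normrN1 mul1r. Qed.

(* Choosing [z j - delta j = z j] with probability [1 - z j] and [z j - 1] otherwise
   gives mean zero; the greedy choice below never exceeds the mean of the square. *)
Lemma rounding (I J : finType) (A : I -> J -> R) (z : J -> R) :
  (forall j, 0 <= z j <= 1) ->
  exists delta : J -> bool,
    \sum_i (\sum_j (z j - (delta j)%:R) * A i j) ^+ 2 <= \sum_j 4^-1 * \sum_i A i j ^+ 2.
Proof.
move=> z01.
(* The offset [b] carries the contribution of the coordinates already rounded. *)
suff H (s : seq J) (b : I -> R) : uniq s -> exists delta : J -> bool,
    \sum_i (b i + \sum_(j <- s) (z j - (delta j)%:R) * A i j) ^+ 2 <=
    \sum_i b i ^+ 2 + \sum_(j <- s) 4^-1 * \sum_i A i j ^+ 2.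
  have [delta Hd] := H (index_enum J) (fun=> 0) (index_enum_uniq _).
  exists delta; move: Hd; rewrite [X in _ <= X + _]big1; last by move=> i _; rewrite expr0n.
  by rewrite add0r; under eq_bigr do rewrite add0r.
elim: s b => [|k s IH] b /=.
  by exists xpredT; rewrite big_nil addr0; under eq_bigr do rewrite big_nil addr0.
move=> /andP[ks us].
have [e He] : exists e : bool, \sum_i (b i + (z k - e%:R) * A i k) ^+ 2 <=
    \sum_i b i ^+ 2 + 4^-1 * \sum_i A i k ^+ 2.
  have E (c : R) : \sum_i (b i + c * A i k) ^+ 2 =
      \sum_i b i ^+ 2 + 2 * c * \sum_i b i * A i k + c ^+ 2 * \sum_i A i k ^+ 2.
    rewrite !mulr_sumr -!big_split/=; apply: eq_bigr => i _; ring.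
  set Q := \sum_i A i k ^+ 2; set B := \sum_i b i * A i k.
  have Q0 : 0 <= Q by apply: sumr_ge0 => i _; exact: sqr_ge0.
  have /andP[z0 z1] := z01 k.
  have [B0|B0] := leP (2 * z k * B + z k ^+ 2 * Q) (4^-1 * Q).
    by exists false; rewrite subr0 E -addrA lerD2l.
  (* Averaging the two choices with weights [1 - z k] and [z k] cancels [B] and leaves
     [z k * (1 - z k) * Q], at most [Q / 4]; if one choice exceeds the bound, the other meets it. *)
  exists true; rewrite E -addrA lerD2l -/Q -/B.
  have [zk|zk0] := eqVneq (z k) 0.
    by exfalso; move: B0; rewrite zk expr0n/= mulr0 !mul0r addr0; lra.
  have {}zk0 : 0 < z k by rewrite lt_def zk0.
  rewrite -(ler_pM2l zk0).
  have : (1 - z k) * (4^-1 * Q) <= (1 - z k) * (2 * z k * B + z k ^+ 2 * Q).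
    by rewrite ler_wpM2l ?subr_ge0// ltW.
  have : 0 <= Q * (z k - 2^-1) ^+ 2 by rewrite mulr_ge0// sqr_ge0.
  by rewrite /=; nra.
have [delta Hd] := IH (fun i => b i + (z k - e%:R) * A i k) us.
exists (fun j => if j == k then e else delta j).
rewrite big_cons addrA; apply: le_trans (lerD He (lexx _)).
rewrite [X in X <= _](_ : _ = \sum_i (b i + (z k - e%:R) * A i k +
   \sum_(j <- s) (z j - (delta j)%:R) * A i j) ^+ 2)//.
apply: eq_bigr => i _; rewrite big_cons eqxx addrA; congr ((_ + _) ^+ 2).
by apply: eq_big_seq => j js; case: eqP => // jk; rewrite -jk js in ks.
Qed.

End Euclidean.

(** * The lattice points and their number *)

Section Net.
Context (R : realType).

Lemma geometric_sum_le (q : R) B : 0 <= q < 1 -> \sum_(i < B) q ^+ i <= (1 - q)^-1.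
Proof.
move=> /andP[q0 q1]; have q1' : 0 < 1 - q by rewrite subr_gt0.
rewrite -(ler_pM2l q1') divff ?gt_eqF//.
have := subrX1 q B; rewrite -opprB -[q - 1]opprB mulNr => /oppr_inj <-.
by rewrite lerBlDr lerDl exprn_ge0.
Qed.

(* A net index stores, for each coordinate, a dyadic scale exponent, a magnitude and a sign. *)
Definition net_index n B := {ffun 'I_n -> 'I_B * 'I_B * bool}.

Definition scale n B (f : net_index n B) j : nat := (f j).1.1.
Definition magnitude n B (f : net_index n B) j : nat := (f j).1.2.

Definition net_point n B (eps : R) (f : net_index n B) : 'cV[R]_n :=
  \col_j ((-1) ^+ (f j).2 * (magnitude f j)%:R * (eps / 2 ^+ scale f j / Num.sqrt n%:R)).

(** The first condition encodes the bound on the product of column norms. As magnitude over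
    [2 ^+ scale] is [|y_j| * sqrt n / eps], the second is an l1 bound on the point, which
    Cauchy-Schwarz gives when its norm is at most [1 + eps]. *)
Definition admissible n B (rho M : R) (f : net_index n B) : bool :=
  (4 ^+ (\sum_j scale f j)%N <= M) &&
  (\sum_j (magnitude f j)%:R / 2 ^+ scale f j <= n%:R * rho).

(** Counting by exponential weights: [M * \prod_j F (f j)] is at least 1 at each admissible [f], and
    its sum over all [f] is [M] times the [n]-th power of a sum for one coordinate. That sum is
    bounded uniformly in [B]. *)
Lemma card_admissible n B (rho M : R) : 1 <= rho -> 0 <= M ->
  #|[pred f : net_index n B | admissible rho M f]|%:R <= M * (8 * expR 1 * rho) ^+ n.
Proof.
move=> rho1 M0; have rho0 : 0 < rho by exact: lt_le_trans rho1.
pose F (p : 'I_B * 'I_B * bool) : R :=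
  expR 1 * ((4^-1) ^+ p.1.1 * expR (- (2 ^+ p.1.1 * rho)^-1) ^+ p.1.2).
have F0 p : 0 <= F p by rewrite !mulr_ge0 ?expR_ge0// exprn_ge0 ?expR_ge0 ?invr_ge0.
apply: (@le_trans _ _ (M * \sum_(f : net_index n B) \prod_j F (f j))).
  rewrite -sum1_card natr_sum mulr_sumr big_mkcond/=; apply: ler_sum => f _.
  have M0' : 0 <= M * \prod_j F (f j) by rewrite mulr_ge0// prodr_ge0.
  rewrite inE; case: ifP => // /andP[fM frho].
  set S := \sum_j _ in frho; set k := (\sum_j _)%N in fM.
  have -> : \prod_j F (f j) = (4 ^+ k)^-1 * expR (n%:R - S / rho).
    rewrite /F !big_split/= prodr_const card_ord prodrXr exprVn mulrCA; congr (_ * _).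
    rewrite -[n%:R]mulr1 expRD expRM_natl mulr_suml -sumrN expR_sum; congr (_ * _).
    by apply: eq_bigr => j _; rewrite -expRM_natl mulrN invfM mulrA.
  rewrite mulrA -[X in X <= _]mulr1 ler_pM//.
    by rewrite ler_pdivlMr ?mul1r// exprn_gt0.
  by rewrite -[X in X <= _]expR0 ler_expR subr_ge0 ler_pdivrMr.
have -> : \sum_(f : net_index n B) \prod_j F (f j) = (\sum_p F p) ^+ n.
  by rewrite -(bigA_distr_bigA (fun=> F)) prodr_const card_ord.
rewrite ler_wpM2l// lerXn2r ?nnegrE//.
- by rewrite sumr_ge0.
- by rewrite !mulr_ge0 ?expR_ge0// ltW.
have -> : \sum_p F p = \sum_(k < B) \sum_(a < B) \sum_(b : bool) F (k, a, b).
  by rewrite pair_bigA/= pair_bigA/=; apply: eq_bigr => -[[]].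
(* The geometric series over magnitudes costs [2 ^+ k], and the weight [4^-1 ^+ k] turns this into a
   summable [2^-1 ^+ k]. *)
have Hk (k : 'I_B) : \sum_(a < B) \sum_(b : bool) F (k, a, b) <= 4 * expR 1 * rho * 2^-1 ^+ k.
  have s0 : 0 < 2 ^+ k * rho by rewrite mulr_gt0// exprn_gt0.
  have s1 : 1 <= 2 ^+ k * rho by rewrite mulr_ege1// exprn_ege1// ler1n.
  set q := expR (- (2 ^+ k * rho)^-1).
  have q1 : q < 1 by rewrite -[X in _ < X]expR0 ltr_expR oppr_lt0 invr_gt0.
  have -> : \sum_(a < B) \sum_(b : bool) F (k, a, b) =
      2 * expR 1 * (4^-1) ^+ k * \sum_(a < B) q ^+ a.
    rewrite mulr_sumr; apply: eq_bigr => a _; rewrite big_bool/= /F/= -/q; ring.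
  have Hq : \sum_(a < B) q ^+ a <= 2 * (2 ^+ k * rho).
    apply: (le_trans (geometric_sum_le _ _)); first by rewrite expR_ge0.
    have : q^-1 >= 1 + (2 ^+ k * rho)^-1 by rewrite /q -expRN opprK expR_ge1Dx.
    set s := 2 ^+ k * rho in s0 s1 *.
    have q0 : 0 < q by exact: expR_gt0.
    move=> Hq; rewrite -[X in _ <= X]invrK lef_pV2 ?posrE ?subr_gt0 ?invr_gt0 ?mulr_gt0//.
    have : q <= s / (s + 1).
      rewrite -[q]invrK -[X in _ <= X]invrK lef_pV2 ?posrE ?invr_gt0 ?divr_gt0 ?addr_gt0//.
      by rewrite invf_div mulrDl divff ?gt_eqF// mul1r.
    move=> H; apply: (@le_trans _ _ (1 - s / (s + 1))); last by rewrite lerD2l lerN2.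
    rewrite (_ : 1 - s / (s + 1) = (s + 1)^-1); last by field; rewrite gt_eqF ?addr_gt0.
    by rewrite lef_pV2 ?posrE ?mulr_gt0 ?addr_gt0//; lra.
  apply: (le_trans (ler_wpM2l _ Hq)); first by rewrite !mulr_ge0 ?expR_ge0// exprn_ge0.
  rewrite (_ : 4^-1 = 2^-1 * 2^-1 :> R); last by field.
  rewrite exprMn [X in X <= _](_ : _ = 4 * expR 1 * rho * 2^-1 ^+ k * (2^-1 * 2) ^+ k); last first.
    by rewrite exprMn; ring.
  by rewrite mulVf// expr1n mulr1.
apply: (le_trans (ler_sum _ (fun k _ => Hk k))).
rewrite -mulr_sumr (_ : 8 * expR 1 * rho = 4 * expR 1 * rho * 2); last by ring.
apply: ler_wpM2l; first by rewrite !mulr_ge0 ?expR_ge0// ltW.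
apply: (le_trans (geometric_sum_le _ _)); first by lra.
by rewrite (_ : 1 - 2^-1 = 2^-1) ?invrK//; field.
Qed.

End Net.

(** * Approximation of unit vectors by admissible lattice points *)

Section Covering.
Context (R : realType).

Lemma exists_pow4_floor (w : R) : 1 <= w -> exists k, 4 ^+ k <= w < 4 ^+ k.+1.
Proof.
move=> w1.
have [m wm] : exists m : nat, w < 4 ^+ m.
  exists (Num.truncn w).+1; apply: (lt_le_trans (truncnS_gt w)).
  by rewrite -natrX ler_nat ltnW// ltn_expl.
elim: m wm => [|m IH] wm; first by move: (lt_le_trans wm w1); rewrite ltxx.
have [/IH//|mw] := ltP w (4 ^+ m).
by exists m; rewrite mw wm.
Qed.

Lemma covering N n B (G : 'M[R]_(N, n)) (eps M : R) (x : 'cV[R]_n) :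
  (0 < n)%N -> (0 < N)%N -> 0 < eps -> l2norm x = 1 ->
  \prod_(j < n) (1 + (\sum_(i < N) G i j ^+ 2) / N%:R) <= M ->
  M * (n%:R * ((1 + eps) / eps)) < B%:R ->
  exists f : net_index n B, [/\ admissible ((1 + eps) / eps) M f,
    l2norm (x - net_point eps f) <= eps &
    l2norm (G *m (x - net_point eps f)) <= eps * Num.sqrt N%:R].
Proof.
move=> n0 N0 eps0 x1 wM MB.
have n0' : 0 < n%:R :> R by rewrite ltr0n.
have N0' : 0 < N%:R :> R by rewrite ltr0n.
have sn0 : 0 < Num.sqrt n%:R :> R by rewrite sqrtr_gt0.
pose S j := \sum_(i < N) G i j ^+ 2.
have S0 j : 0 <= S j by apply: sumr_ge0 => i _; exact: sqr_ge0.
have w1 j : 1 <= 1 + S j / N%:R by rewrite lerDl divr_ge0// ltW.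
have /choice[k kw] := fun j => exists_pow4_floor (w1 j).
have p4 j : 0 < 4 ^+ k j :> R by rewrite exprn_gt0.
have p2 j : 0 < 2 ^+ k j :> R by rewrite exprn_gt0.
have p24 j : (2 ^+ k j) ^+ 2 = 4 ^+ k j :> R.
  by rewrite -exprM mulnC exprM; congr (_ ^+ _); rewrite expr2; ring.
pose h j : R := eps / 2 ^+ k j / Num.sqrt n%:R.
have h0 j : 0 < h j by rewrite !divr_gt0.
have hE j : h j ^+ 2 = eps ^+ 2 / 4 ^+ k j / n%:R.
  by rewrite /h !expr_div_n p24 sqr_sqrtr// ltW.
pose c j := x j ord0 / h j.
pose z j := c j - (Num.floor (c j))%:~R.
have z01 j : 0 <= z j <= 1.
  have /andP[c0 c1] := floor_itv (c j).
  by rewrite /z subr_ge0 c0/= lerBlDl -intrD1 ltW.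
(* [z j] is the fractional part of [x_j] in units of the spacing [h j]; the columns are scaled by
   the same unit. *)
have [delta Hdelta] := rounding (fun i j => h j * G i j) z01.
pose m j : int := Num.floor (c j) + (delta j : nat)%:Z.
pose y : 'cV[R]_n := \col_j ((m j)%:~R * h j).
have fE j : (x - y) j ord0 = (z j - (delta j)%:R) * h j.
  rewrite !mxE /m /z /c intrD -pmulrn; field.
  by rewrite gt_eqF.
have xy : l2norm (x - y) <= eps.
  rewrite l2norm_le; last exact: ltW.
  apply: (@le_trans _ _ (\sum_(j < n) eps ^+ 2 / n%:R)); last first.
    by rewrite sumr_const card_ord -[X in X <= _]mulr_natr divfK// gt_eqF.
  apply: ler_sum => j _; rewrite fE exprMn hE mulrA ler_wpM2r ?invr_ge0//.
  rewrite mulrCA; apply: ler_piMr; first exact: sqr_ge0.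
  have /andP[z0 z1] := z01 j.
  have : (4 ^+ k j)^-1 <= 1 :> R by rewrite invf_le1// exprn_ege1// ler1n.
  have : (z j - (delta j)%:R) ^+ 2 <= 1 by case: (delta j) => /=; nra.
  move=> H1 H2; rewrite -[X in _ <= X]mulr1 ler_pM ?sqr_ge0 ?invr_ge0//.
have Gxy : l2norm (G *m (x - y)) <= eps * Num.sqrt N%:R.
  rewrite l2norm_le; last by rewrite mulr_ge0 ?sqrtr_ge0// ltW.
  rewrite exprMn sqr_sqrtr ?(ltW N0')//.
  apply: (@le_trans _ _ (\sum_(j < n) eps ^+ 2 / n%:R * N%:R)); last first.
    by rewrite sumr_const card_ord -[X in X <= _]mulr_natr mulrAC divfK// gt_eqF.
  apply: (@le_trans _ _ (\sum_(j < n) 4^-1 * \sum_(i < N) (h j * G i j) ^+ 2)).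
    apply: le_trans Hdelta; apply: ler_sum => i _.
    rewrite mxE [X in X ^+ 2 <= _](_ : _ = \sum_j (z j - (delta j)%:R) * (h j * G i j))//.
    by apply: eq_bigr => j _; rewrite fE mulrC -mulrA.
  apply: ler_sum => j _.
  under eq_bigr do rewrite exprMn.
  rewrite -mulr_sumr -/(S j) hE.
  (* The 1/4 from rounding absorbs the 4 in [S j / N <= 4 * 4 ^+ k j], so each column costs at most
     [eps ^+ 2 * N / n]. *)
  have /andP[_ ] := kw j; rewrite exprS => Hw.
  have : S j / N%:R <= 4 * 4 ^+ k j by lra.
  rewrite ler_pdivrMr// => HS.
  rewrite (_ : 4^-1 * _ = eps ^+ 2 / n%:R * (S j / (4 * 4 ^+ k j))); last first.
    by field; rewrite !gt_eqF//.
  rewrite ler_wpM2l ?divr_ge0 ?sqr_ge0 ?(ltW n0')//.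
  by rewrite ler_pdivrMr ?mulr_gt0// mulrC.
have r0 : 0 < 1 + eps by lra.
have ynorm : l2norm y <= 1 + eps.
  by rewrite (le_trans (l2norm_sub y x))// x1 lerD2l l2normB.
have yE j : `|m j|%:R / 2 ^+ k j = `|y j ord0| * Num.sqrt n%:R / eps.
  rewrite mxE normrM (gtr0_norm (h0 j)) /h natr_absz intr_norm; field.
  by rewrite !gt_eqF.
have sumy : \sum_j `|m j|%:R / 2 ^+ k j <= n%:R * ((1 + eps) / eps).
  under eq_bigr do rewrite yE.
  rewrite -mulr_suml mulrA ler_wpM2r ?invr_ge0 ?(ltW eps0)// -mulr_suml.
  rewrite -[X in X * (1 + eps)](sqr_sqrtr (ltW n0')) expr2 -mulrA mulrC ler_wpM2l ?(ltW sn0)//.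
  (* Cauchy-Schwarz as a termwise AM-GM inequality, with equality at
     [|y_j| = (1 + eps) / sqrt n]. *)
  apply: (@le_trans _ _ (\sum_(j < n) 2^-1 *
     (Num.sqrt n%:R / (1 + eps) * y j ord0 ^+ 2 + (1 + eps) / Num.sqrt n%:R))).
    apply: ler_sum => j _; rewrite -[y j ord0 ^+ 2]real_normK ?num_real// -subr_ge0.
    set t := `|_|.
    rewrite (_ : _ - t = 2^-1 * (Num.sqrt n%:R * t - (1 + eps)) ^+ 2 / ((1 + eps) * Num.sqrt n%:R)).
      by apply: divr_ge0; [rewrite mulr_ge0 ?sqr_ge0 ?invr_ge0|rewrite ltW// mulr_gt0].
    by field; rewrite !gt_eqF.
  rewrite -mulr_sumr big_split/= -mulr_sumr -l2norm_sqr sumr_const card_ord.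
  have -> : ((1 + eps) / Num.sqrt n%:R) *+ n = Num.sqrt n%:R * (1 + eps).
    by rewrite -mulr_natr -[X in _ * X](sqr_sqrtr (ltW n0')); field; rewrite gt_eqF.
  have : l2norm y ^+ 2 <= (1 + eps) ^+ 2 by rewrite ler_pXn2r ?nnegrE ?l2norm_ge0// ltW.
  move=> /(ler_wpM2l (ltW (divr_gt0 sn0 r0))).
  rewrite [X in _ <= X](_ : _ = Num.sqrt n%:R * (1 + eps)); last by field; rewrite gt_eqF.
  by lra.
have k4M : 4 ^+ (\sum_j k j)%N <= M.
  apply: le_trans wM; rewrite -prodrXr; apply: ler_prod => j _.
  by rewrite ltW//=; have /andP[] := kw j.
have kM j : 4 ^+ k j <= M.
  by apply: le_trans k4M; rewrite ler_weXn2l ?ler1n// (bigD1 j)//= leq_addr.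
have rho1 : 1 <= n%:R * ((1 + eps) / eps).
  have : 1 <= n%:R :> R by rewrite ler1n.
  have : 1 <= (1 + eps) / eps by rewrite ler_pdivlMr// mul1r; lra.
  by move=> *; rewrite mulr_ege1.
(* The exponents fit below [B] since [k j <= 4 ^+ k j <= M], and the magnitudes since they are at
   most [2 ^+ k j * n * rho <= M * n * rho]. *)
have kB j : (k j < B)%N.
  rewrite -(ltr_nat R); apply: le_lt_trans MB; apply: (@le_trans _ _ M).
    by apply: le_trans (kM j); rewrite -natrX ler_nat ltnW// ltn_expl.
  by rewrite ler_peMr// (le_trans (ltW (p4 j))).
have aB j : (`|m j| < B)%N.
  rewrite -(ltr_nat R); apply: le_lt_trans MB.
  have : `|m j|%:R / 2 ^+ k j <= n%:R * ((1 + eps) / eps).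
    by apply: le_trans sumy; rewrite (bigD1 j)//= lerDl sumr_ge0.
  rewrite ler_pdivrMr// => /le_trans; apply; rewrite mulrC ler_wpM2r ?(le_trans _ rho1)//.
  by apply: le_trans (kM j); rewrite lerXn2r ?nnegrE ?ler_nat.
exists [ffun j => (Ordinal (kB j), Ordinal (aB j), m j < 0)].
rewrite (_ : net_point _ _ = y).
  split => //; apply/andP; split.
    by under eq_bigr do rewrite /scale ffunE.
  by under eq_bigr do rewrite /scale /magnitude ffunE.
apply/colP => j; rewrite !mxE /scale /magnitude ffunE/= -/(h j).
by rewrite [in RHS](intEsign (m j)) rmorphM/= rmorphXn/= rmorphN1.
Qed.

End Covering.

(** * Measurability of the smallest singular value *)

Section SmallestSingularValue.
Context (R : realType).

Lemma sphere_neq0 n : (0 < n)%N -> @sphere R n !=set0.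
Proof.
move=> n0; exists (\col_j (j == Ordinal n0)%:R).
rewrite /sphere /= /l2norm (bigD1 (Ordinal n0))//= big1 ?addr0.
  by rewrite mxE eqxx expr1n sqrtr1.
by move=> j /negbTE jn; rewrite mxE jn expr0n.
Qed.

(** Strictness gives a witness from the infimum alone, without compactness; [0 < n] keeps the sphere
    nonempty. *)
Lemma smallest_singular_value_lt N n (A : 'M[R]_(N, n)) (t : R) : (0 < n)%N ->
  smallest_singular_value A < t -> exists2 x, sphere x & l2norm (A *m x) < t.
Proof.
move=> n0 /inf_lt[|_ [x sx <-] xt]; last by exists x.
by have [x sx] := sphere_neq0 n0; exists (l2norm (A *m x)), x.
Qed.

(** Homogeneity admits witnesses off the sphere, such as rational vectors; the strict inequality
    forces [x] to be nonzero. *)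
Lemma smallest_singular_value_le N n (A : 'M[R]_(N, n)) (x : 'cV[R]_n) (t : R) :
  l2norm (A *m x) < t * l2norm x -> smallest_singular_value A <= t.
Proof.
move=> xt; have x0 : 0 < l2norm x.
  rewrite lt_neqAle l2norm_ge0 andbT eq_sym; apply: contraTneq xt => x0.
  by rewrite x0 mulr0 -leNgt l2norm_ge0.
apply: (@le_trans _ _ (l2norm (A *m ((l2norm x)^-1 *: x)))).
  apply: ge_inf; first by exists 0 => _ [z _ <-]; exact: l2norm_ge0.
  exists ((l2norm x)^-1 *: x) => //.
  by rewrite /sphere /= l2normZ ger0_norm ?invr_ge0 ?l2norm_ge0// mulVf ?gt_eqF.
rewrite -scalemxAr l2normZ ger0_norm ?invr_ge0 ?l2norm_ge0//.
by rewrite mulrC ler_pdivrMr// ltW.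
Qed.

Lemma l2norm_mul_le N n (A : 'M[R]_(N, n)) :
  exists2 C, 0 <= C & forall (y : 'cV[R]_n) e, 0 <= e -> (forall j, `|y j ord0| <= e) ->
    l2norm (A *m y) <= C * e.
Proof.
exists (Num.sqrt (\sum_i (\sum_j `|A i j|) ^+ 2)); first exact: sqrtr_ge0.
move=> y e e0 ye; rewrite l2norm_le ?mulr_ge0 ?sqrtr_ge0//.
rewrite exprMn sqr_sqrtr; last by rewrite sumr_ge0// => i _; exact: sqr_ge0.
rewrite mulr_suml; apply: ler_sum => i _; rewrite -exprMn -ler_sqrt ?sqr_ge0//.
rewrite !sqrtr_sqr [X in _ <= X]ger0_norm; last first.
  by rewrite mulr_ge0// sumr_ge0.
rewrite mxE mulr_suml; apply: (le_trans (ler_norm_sum _ _ _)); apply: ler_sum => j _.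
by rewrite normrM ler_wpM2l.
Qed.

Lemma exists_rat_vector N n (A : 'M[R]_(N, n)) (x : 'cV[R]_n) (t : R) :
  0 <= t -> l2norm x = 1 -> l2norm (A *m x) < t ->
  exists q : 'cV[rat]_n, l2norm (A *m map_mx ratr q) < t * l2norm (map_mx ratr q).
Proof.
move=> t0 x1 Axt; have [C C0 HC] := l2norm_mul_le A.
have [D D0 HD] := l2norm_mul_le (1%:M : 'M[R]_n).
(* Moving [x] by [e] per coordinate costs [C * e] on the left and [t * D * e] on the right; the
   extra 1 keeps the inequality strict. *)
pose e := (t - l2norm (A *m x)) / (C + t * D + 1).
have S0 : 0 < C + t * D + 1 by rewrite ltr_wpDl// addr_ge0// mulr_ge0.
have e0 : 0 < e by rewrite divr_gt0// subr_gt0.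
have /choice[q Hq] : forall j, exists q : rat, `|ratr q - x j ord0| <= e.
  move=> j; have /rat_in_itvoo[q] : x j ord0 - e < x j ord0 + e by lra.
  by rewrite in_itv/= => qe; exists q; rewrite ler_distl; apply/andP; split; lra.
exists (\col_j q j); set y := map_mx _ _.
have ye j : `|(y - x) j ord0| <= e by rewrite !mxE; exact: Hq.
have H1 := HC _ _ (ltW e0) ye.
have := HD _ _ (ltW e0) ye; rewrite mul1mx => H2.
have H3 : l2norm (A *m y) <= l2norm (A *m x) + C * e.
  by apply: (le_trans (l2norm_sub _ (A *m x))); rewrite lerD2l -mulmxBr.
have H4 : 1 <= l2norm y + D * e.
  by rewrite -x1 (le_trans (l2norm_sub _ y))// lerD2l l2normB.
have He : (C + t * D + 1) * e = t - l2norm (A *m x) by rewrite /e mulrCA divff ?mulr1// gt_eqF.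
have := ler_wpM2l t0 H4.
by nra.
Qed.

(** Density of rational vectors, with slack [k.+1%:R^-1] in the threshold, writes the event as a
    countable intersection of countable unions. *)
Lemma measurable_smallest_singular_value d (T : measurableType d) (P : probability T R)
    N n (xi : 'I_N -> 'I_n -> {RV P >-> R}) (t : R) : (0 < n)%N -> 0 <= t ->
  measurable [set w | smallest_singular_value (random_matrix xi w) <= t].
Proof.
move=> n0 t0.
pose F k (q : 'cV[rat]_n) := [set w | l2norm (random_matrix xi w *m map_mx ratr q) <
  (t + k.+1%:R^-1) * l2norm (map_mx (@ratr R) q)].
rewrite (_ : [set w | _] = \bigcap_(k in [set: nat]) \bigcup_(q in setT) F k q).
  apply: bigcapT_measurable => k; apply: countable_bigcupT_measurable.
    exact: countableP.
  move=> q; pose a : R := (t + k.+1%:R^-1) * l2norm (map_mx (@ratr R) q).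
  rewrite (_ : F k q = (fun w => l2norm (random_matrix xi w *m map_mx ratr q)) @^-1` `]-oo, a[).
    rewrite -[X in measurable X]setTI.
    by apply: (measurable_l2norm_random_matrix xi (map_mx ratr q)).
  by apply/seteqP; split => w /=; rewrite in_itv.
apply/seteqP; split => w /=.
  move=> wt k _.
  have [|x sx xt] := @smallest_singular_value_lt _ _ (random_matrix xi w) (t + k.+1%:R^-1) n0.
    by rewrite (le_lt_trans wt)// ltrDl.
  have [|q Hq] := exists_rat_vector _ sx xt; first by rewrite addr_ge0.
  by exists q.
move=> H; apply/ler_addgt0Pr => e e0.
have [q _ Hq] := H (Num.truncn e^-1) Logic.I.
apply: (le_trans (smallest_singular_value_le Hq)); rewrite lerD2l.
by rewrite -[X in _ <= X]invrK lef_pV2 ?posrE ?invr_gt0// ltW// truncnS_gt.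
Qed.

End SmallestSingularValue.

(** * The union bound *)

Section Constants.
Context (R : realType).

Lemma ln_le_subr1 (y : R) : 0 < y -> ln y <= y - 1.
Proof.
move=> y0; rewrite -[X in ln X](subrKC 1).
by apply: le_ln1Dx; lra.
Qed.

Lemma expR1_le4 : expR 1 <= 4 :> R.
Proof.
rewrite [X in expR X](_ : _ = 2%:R * 2^-1); last by field.
rewrite expRM_natl (_ : 4 = 2 ^+ 2 :> R); last by rewrite expr2; ring.
rewrite lerXn2r ?nnegrE ?expR_ge0//.
rewrite -[X in X <= _]invrK -expRN invf_ple ?posrE ?expR_gt0//.
by have := expR_ge1Dx (- 2^-1 : R); lra.
Qed.

Lemma c_uv_bounds (c u v : R) : 0 < c <= 1 -> 0 < u < 1 -> 0 < v < 1 ->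
  [/\ 0 < c_uv c u v, c_uv c u v <= 2^-1, c_uv c u v <= v & c_uv c u v ^+ 2 <= 1 - v].
Proof.
move=> /andP[c0 c1] /andP[u0 u1] /andP[v0 v1].
have w0 : 0 < 1 - v by rewrite subr_gt0.
set s := Num.sqrt (1 - v).
have s0 : 0 < s by rewrite sqrtr_gt0.
have s2 : s ^+ 2 = 1 - v by rewrite sqr_sqrtr// ltW.
have s1 : s < 1 by rewrite -(ltr_pXn2r (n := 2)) ?nnegrE ?(ltW s0)// s2 expr1n; lra.
have a0 : 0 < c_uv c u v by rewrite !mulr_gt0.
have cu : c * u <= 1 by rewrite mulr_ile1// ltW.
have av : c_uv c u v <= v * s.
  by rewrite /c_uv -/s -mulrA ler_piMl// ltW// mulr_gt0.
have vs : v * s <= 2^-1.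
  have -> : v = 1 - s ^+ 2 by rewrite s2; lra.
  (* Expanded, this says [s - s ^+ 3 <= (s + 1) / 4], which is below 1/2. *)
  have : 0 <= (s - 2^-1) ^+ 2 * (s + 1) by rewrite mulr_ge0 ?sqr_ge0//; lra.
  by nra.
split => //.
- exact: le_trans vs.
- by rewrite (le_trans av)// ler_piMr// ltW.
- rewrite -s2 lerXn2r ?nnegrE ?(ltW a0) ?(ltW s0)// (le_trans av)//.
  by rewrite ler_piMl// ltW.
Qed.

(** The equality shows what the two constants are: with [L = gamma1 v ^+ 2], the Chernoff factor of
    one row is [expR (- gamma2 v)]. The last bound makes the net's mesh small against the target
    singular value. *)
Lemma gamma_relations (a v : R) : 0 < v < 1 -> 0 < a -> a <= v -> a ^+ 2 <= 1 - v ->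
  [/\ 0 < gamma1 v, 0 < gamma2 v,
    v + (1 - v) * expR (- gamma1 v ^+ 2) = expR (- gamma2 v) &
    gamma1 v ^+ 2 * a ^+ 2 / 4 <= gamma2 v].
Proof.
move=> /andP[v0 v1] a0 av a2; rewrite /gamma1 /gamma2; case: ifP => v2.
  have ln20 : 0 < ln 2 :> R by rewrite ln_gt0// ltr1n.
  have ln21 : ln 2 <= 1 :> R by have := @ln_le_subr1 2; lra.
  have g2 : (1 - v) / 2 <= ln (2 / (1 + v)).
    rewrite -[2 / (1 + v)]invf_div lnV ?posrE ?divr_gt0 ?addr_gt0//.
    by have := @ln_le_subr1 ((1 + v) / 2); lra.
  rewrite sqr_sqrtr ?(ltW ln20)// sqrtr_gt0; split => //; first by lra.
    by rewrite !expRN !lnK ?posrE ?divr_gt0 ?addr_gt0// invf_div; field; rewrite ?gt_eqF ?addr_gt0.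
  by apply: le_trans g2; nra.
have {}v2 : v < 1 / 2 by rewrite ltNge v2.
have ln0 : 0 < ln (1 / v) by rewrite ln_gt0// ltr_pdivlMr// mul1r.
have w0 : 0 < 2 * v - v ^+ 2 by nra.
have g2 : (1 - v) ^+ 2 <= ln (1 / (2 * v - v ^+ 2)).
  rewrite div1r lnV ?posrE//.
  by have := ln_le_subr1 w0; lra.
rewrite sqr_sqrtr ?(ltW ln0)// sqrtr_gt0; split => //; first by nra.
  by rewrite !expRN !lnK ?posrE ?divr_gt0// !div1r !invrK; ring.
have lv : v * ln (1 / v) <= 1.
  by rewrite mulrC -ler_pdivlMr// ltW// ln_sublinear// divr_gt0.
have : a ^+ 2 <= v ^+ 2 by rewrite lerXn2r ?nnegrE ?(ltW a0)// ltW.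
move=> /(ler_wpM2l (ltW ln0)).
by nra.
Qed.

(** With [b = a^-1 >= 2], the base is at most [64 * 33 * b ^+ 2], and
    [64 * 33 <= 2 ^+ 14 <= b ^+ 14]. *)
Lemma net_cardinality_bound (a : R) n : 0 < a -> a <= 2^-1 ->
  (16 * expR 1 * ((1 + a ^+ 2 / 32) / (a ^+ 2 / 32))) ^+ n <= expR (16 * ln (1 / a) * n%:R).
Proof.
move=> a0 a2.
rewrite [X in _ <= expR X]mulrC expRM_natl; apply: lerXn2r.
- have x0 : 0 <= a ^+ 2 / 32 by rewrite divr_ge0// sqr_ge0.
  rewrite nnegrE; apply: mulr_ge0; first by rewrite mulr_ge0 ?expR_ge0.
  by apply: divr_ge0 => //; rewrite addr_ge0.
- by rewrite nnegrE expR_ge0.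
have -> : expR (16 * ln (1 / a)) = a^-1 ^+ 16.
  by rewrite (expRM_natl 16) lnK ?posrE ?divr_gt0// div1r.
have b2 : 2 <= a^-1 by rewrite -[2]invrK lef_pV2 ?posrE.
set b := a^-1 in b2 *.
have -> : (1 + a ^+ 2 / 32) / (a ^+ 2 / 32) = 1 + 32 * b ^+ 2.
  by rewrite /b; field; rewrite gt_eqF.
apply: (@le_trans _ _ (64 * (33 * b ^+ 2))).
  have b20 : 0 <= b ^+ 2 by exact: sqr_ge0.
  apply: ler_pM.
  - by rewrite mulr_ge0 ?expR_ge0.
  - by lra.
  - by have := expR1_le4; lra.
  - by have : 1 <= b ^+ 2 by [rewrite exprn_ege1//; lra]; lra.
rewrite mulrA (_ : 16%N = (14 + 2)%N)// exprD ler_wpM2r ?sqr_ge0//.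
apply: (@le_trans _ _ (2 ^+ 14)); first by rewrite -!natrX -!natrM ler_nat.
by apply: lerXn2r; rewrite ?nnegrE//; lra.
Qed.

End Constants.

Section NetPoints.
Context d (T : measurableType d) (R : realType) (P : probability T R).

Lemma net_point_small_ball N n (xi : 'I_N -> 'I_n -> {RV P >-> R})
    (y : 'cV[R]_n) (a v t eps : R) :
  mutually_independent (fun ij : 'I_N * 'I_n => xi ij.1 ij.2) ->
  0 < v < 1 -> 0 < a -> a <= v -> a ^+ 2 <= 1 - v ->
  (forall i (x : 'cV[R]_n), sphere x ->
    (concentration P (fun w => (\sum_(j < n) x j ord0 * xi i j w)%R) a <= v%:E)%E) ->
  t = a * Num.sqrt (gamma2 v) / (4 * gamma1 v) ->
  0 < eps -> eps <= t / 4 -> eps <= 16^-1 -> 1 - eps <= l2norm y ->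
  (P [set w | (l2norm (random_matrix xi w *m y) <=
       (5 / 4 * t + eps) * Num.sqrt N%:R)%R]
    <= (expR (- (3 / 4 * gamma2 v * N%:R)))%:E)%E.
Proof.
move=> indxi v01 a0 av a2 conc tE eps0 epst eps1 y1.
have [g10 g20 gE _] := gamma_relations v01 a0 av a2.
have y0 : 0 < l2norm y by lra.
pose x := (l2norm y)^-1 *: y.
have sx : sphere x.
  by rewrite /sphere /= l2normZ ger0_norm ?invr_ge0 ?l2norm_ge0// mulVf ?gt_eqF.
have t0 : 0 < t by rewrite tE divr_gt0 ?mulr_gt0 ?sqrtr_gt0.
set E := [set w | _].
have mE : measurable E by exact: measurable_l2norm_le.
have Es w : E w -> l2norm (random_matrix xi w *m x) <= 2 * t * Num.sqrt N%:R.
  rewrite /E /= => Ew; rewrite -scalemxAr l2normZ ger0_norm ?invr_ge0 ?l2norm_ge0//.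
  rewrite mulrC ler_pdivrMr// (le_trans Ew)// [leRHS]mulrAC ler_wpM2r ?sqrtr_ge0//.
  (* Here [5/4 * t + eps <= 3/2 * t], while [l2norm y >= 15/16]; so passing to the unit vector costs
     at most the factor 2 in [2 * t]. *)
  apply: (@le_trans _ _ (2 * t * (15 / 16))); first by lra.
  by apply: ler_wpM2l; lra.
have := small_ball indxi a0 (sqr_ge0 (gamma1 v)) (fun i => conc i x sx) mE Es.
rewrite gE -expRM_natl -expRD => H; apply: (le_trans H); rewrite lee_fin ler_expR.
(* The value of [t] makes the Chernoff loss [gamma2 v * N / 4], against a gain of [gamma2 v * N]. *)
rewrite -!exprMn (_ : gamma1 v * _ = Num.sqrt (gamma2 v) / 2 * Num.sqrt N%:R); last first.
  by rewrite tE; field; rewrite !gt_eqF.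
rewrite exprMn expr_div_n !sqr_sqrtr// ?(ltW g20)//.
by lra.
Qed.

End NetPoints.

Theorem theorem5p1 (R : realType) (c : R) (hc : rogozin_constant c) :
  exists C0 : R, 1 < C0 /\
  forall (u v : R), 0 < u < 1 -> 0 < v < 1 ->
  forall (n N : nat), (0 < n)%N -> (0 < N)%N ->
  C0 / gamma2 v * ln (1 / c_uv c u v) * n%:R <= N%:R ->
  forall (d : measure_display) (T : measurableType d) (P : probability T R)
    (xi : 'I_N -> 'I_n -> {RV P >-> R}),
  mutually_independent (fun ij : 'I_N * 'I_n => xi ij.1 ij.2) ->
  (forall i j, symmetric_rv P (xi i j)) ->
  (forall i j, 'V_P[xi i j] = 1%E) ->
  (forall i j k, same_distribution P (xi i j) (xi i k)) ->
  (forall i j, (concentration P (xi i j) u <= v%:E)%E) ->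
  (P [set w | (smallest_singular_value (random_matrix xi w) <=
               c_uv c u v * Num.sqrt (gamma2 v) / (4 * gamma1 v)
                 * Num.sqrt N%:R)%R]
   <= (3 * expR (- (Num.min 2 (gamma2 v) * N%:R / 8))%R)%R%:E)%E.
Proof.
case: hc => c0 c1 rogozin.
(* With [a] for [c_uv], the net has at most [e^K (16 e rho)^n <= e^K a^(-16 n)] points;
   the constant 32 turns this into at most [e^K exp (gamma2 N / 2)]. *)
exists 32; split; first by rewrite ltr1n.
move=> u v u01 v01 n N n0 N0 NC d T P xi indxi symxi varxi _ conc.
have c01 : 0 < c <= 1 by rewrite c0.
have [a0 ahalf av a2] := c_uv_bounds c01 u01 v01.
have rog := rogozin u v u01 v01.
move: (c_uv c u v) a0 ahalf av a2 NC rog => a a0 ahalf av a2 NC rog.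
have [g10 g20 gE gL] := gamma_relations v01 a0 av a2.
set t := a * Num.sqrt (gamma2 v) / (4 * gamma1 v).
have t0 : 0 < t by rewrite /t divr_gt0 ?mulr_gt0 ?sqrtr_gt0.
pose eps := a ^+ 2 / 32.
have eps0 : 0 < eps by rewrite divr_gt0// exprn_gt0.
have epst : eps <= t / 4.
  have : gamma1 v * (a / 2) <= Num.sqrt (gamma2 v).
    rewrite -(@ler_pXn2r _ 2) ?nnegrE ?sqrtr_ge0//; last by rewrite mulr_ge0 ?divr_ge0// ltW.
    by rewrite sqr_sqrtr ?(ltW g20)// exprMn expr_div_n -natrX mulrA.
  move=> H; rewrite /eps /t (_ : a ^+ 2 / 32 = a * (gamma1 v * (a / 2)) / (4 * gamma1 v) / 4); last first.
    by field; rewrite gt_eqF.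
  by rewrite !ler_wpM2r ?invr_ge0 ?mulr_ge0 ?(ltW g10)// ler_wpM2l// ltW.
have eps1 : eps <= 16^-1.
  have : a ^+ 2 <= 2^-1 ^+ 2 by rewrite lerXn2r ?nnegrE// ltW.
  by rewrite /eps; lra.
have N0' : 0 < N%:R :> R by rewrite ltr0n.
have sN0 : 0 < Num.sqrt N%:R :> R by rewrite sqrtr_gt0.
pose K := Num.min 2 (gamma2 v) * N%:R / 8.
have Kg : K <= gamma2 v * N%:R / 8.
  by rewrite /K ler_wpM2r ?invr_ge0// ler_wpM2r ?(ltW N0')// ge_min lexx orbT.
pose M : R := 2 ^+ n * expR K.
have M0 : 0 <= M by rewrite mulr_ge0 ?exprn_ge0 ?expR_ge0.
pose rho := (1 + eps) / eps.
have rho1 : 1 <= rho by rewrite /rho ler_pdivlMr// mul1r; lra.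
(* [B] only makes the index set finite; the final estimate does not depend on it. *)
pose B := (Num.truncn (M * (n%:R * rho))).+1.
have MB : M * (n%:R * rho) < B%:R by exact: truncnS_gt.
set E := [set w | _].
have mE : measurable E.
  by apply: measurable_smallest_singular_value => //; rewrite mulr_ge0 ?ltW.
pose good (f : net_index n B) := admissible rho M f && (1 - eps <= l2norm (net_point eps f)).
(* [None] stands for the exceptional event of large column norms, so that one union bound covers
   everything. *)
pose A (o : option (net_index n B)) : set T := if o is Some f
  then [set w | l2norm (random_matrix xi w *m net_point eps f) <= (5 / 4 * t + eps) * Num.sqrt N%:R]
  else [set w | M <= \prod_(j < n) (1 + (\sum_(i < N) xi i j w ^+ 2) / N%:R)].
have mA o : measurable (A o).
  case: o => [f|] /=; first exact: measurable_l2norm_le.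
  rewrite (_ : [set w | _] = (fun w => \prod_(j < n) (1 + (\sum_(i < N) xi i j w ^+ 2) / N%:R)) @^-1`
      `[M, +oo[); last by apply/seteqP; split => w; rewrite /= in_itv/= andbT.
  by rewrite -[X in measurable X]setTI; apply: measurable_prod_column_norms.
pose s := None :: [seq Some f | f <- enum good].
have EA w : E w -> exists2 o, o \in s & A o w.
  move=> Ew; have [wM|wM] := lerP M (\prod_(j < n) (1 + (\sum_(i < N) xi i j w ^+ 2) / N%:R)).
    by exists None.
  (* Raising [t] to [5/4 * t] provides the strict inequality needed for a witness. *)
  have [|x sx xt] := @smallest_singular_value_lt _ _ _ (random_matrix xi w)
      (5 / 4 * t * Num.sqrt N%:R) n0.
    by apply: (le_lt_trans Ew); rewrite ltr_pM2r//; lra.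
  have [|f [fadm xf Gxf]] := covering n0 N0 eps0 sx _ MB (G := random_matrix xi w).
    rewrite ltW//; move: wM; congr (_ < _); apply: eq_bigr => j _.
    by congr (_ + _ / _); apply: eq_bigr => i _; rewrite mxE.
  exists (Some f).
    rewrite inE/= mem_map ?mem_enum; last by move=> ? ? [].
    change (good f); rewrite /good fadm/= lerBlDr -sx.
    by rewrite (le_trans (l2norm_sub x (net_point eps f)))// lerD2l.
  rewrite /=; apply: (le_trans (l2norm_sub _ (random_matrix xi w *m x))).
  rewrite -mulmxBr mulrDl lerD ?(ltW xt)//.
  by rewrite -[net_point eps f - x]opprB mulmxN -scaleN1r l2normZ normrN1 mul1r.
apply: (le_trans (@union_bound _ _ _ P _ _ _ _ mE mA EA)).
rewrite /s big_cons big_map.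
have PNone : (P (A None) <= (expR (- K))%:E)%E.
  by apply: column_norms_tail => // i j; exact: (symmetric_second_moment (symxi i j)).
have PSome f : good f -> (P (A (Some f)) <= (expR (- (3 / 4 * gamma2 v * N%:R)))%:E)%E.
  move=> /andP[_ f1].
  apply: (net_point_small_ball indxi v01 a0 av a2 _ erefl eps0 epst eps1 f1) => i x sx.
  apply: rog => //.
  by apply: (mutually_independent_inj (e := fun j => (i, j)) _ indxi) => j k [].
have PSum : (\sum_(f <- enum good) P (A (Some f)) <=
    (#|[pred f : net_index n B | admissible rho M f]|%:R *
     expR (- (3 / 4 * gamma2 v * N%:R)))%:E)%E.
  rewrite big_enum/=; apply: (@le_trans _ _
      (\sum_(f in good) (expR (- (3 / 4 * gamma2 v * N%:R)))%:E)%E).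
    by apply: lee_sum => f; exact: PSome.
  rewrite sumEFin sumr_const lee_fin -[leLHS]mulr_natl ler_wpM2r ?expR_ge0// ler_nat.
  by apply: subset_leq_card; apply/fintype.subsetP => f /andP[].
apply: (le_trans (leeD PNone PSum)); rewrite -EFinD lee_fin -/K.
(* The column norms and the net then contribute [expR (- K)] each. *)
suff : #|[pred f : net_index n B | admissible rho M f]|%:R *
    expR (- (3 / 4 * gamma2 v * N%:R)) <= expR (- K).
  by have := expR_gt0 (- K); lra.
apply: (le_trans (ler_wpM2r (expR_ge0 _) (card_admissible n B rho1 M0))).
have -> : M * (8 * expR 1 * rho) ^+ n = expR K * (16 * expR 1 * rho) ^+ n.
  rewrite /M mulrAC mulrC -exprMn; congr (_ * _ ^+ _).
  by rewrite !mulrA -natrM.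
have netN := net_cardinality_bound n a0 ahalf.
have ND : 16 * ln (1 / a) * n%:R <= gamma2 v * N%:R / 2.
  move: NC; rewrite (_ : 32 / _ * _ * _ = 32 * ln (1 / a) * n%:R / gamma2 v); last by ring.
  by rewrite ler_pdivrMr//; lra.
rewrite -[leLHS]mulrA; apply: (@le_trans _ _ (expR K * (expR (gamma2 v * N%:R / 2) *
    expR (- (3 / 4 * gamma2 v * N%:R))))).
  rewrite ler_wpM2l ?expR_ge0// ler_wpM2r ?expR_ge0//.
  by apply: (le_trans netN); rewrite ler_expR.
(* The exponent is [K - gamma2 v * N / 4], at most [- K] because [K <= gamma2 v * N / 8]. *)
by rewrite -!expRD ler_expR; lra.
Qed.
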